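(* Let $k\ge3$, let $e$ be an edge of a connected $k$-graph $H$, and let $v_1,\dots,v_s$ ($s\ge2$) be all the vertices of $e$ of degree at least $2$. Let $1\le t<s$ and let $H'$ be obtained from $H$ by releasing $v_1,\dots,v_t$ of $e$. Then $\alpha(H')>\alpha(H)$ and $\rho(H')<\rho(H)$.
   Context: A $k$-graph is a simple $k$-uniform hypergraph. $\rho(H)$ is the spectral radius of the adjacency tensor of $H$ (order $k$, entries $1/(k-1)!$ at index tuples forming an edge, $0$ otherwise; maximal modulus of eigenvalues $\lambda$ with $\mathcal{A}x=\lambda x^{[k-1]}$, $x\neq0$), and $\alpha(H)=\rho(H)^{-k}$. Releasing $v_1,\dots,v_t$ of $e$: with new vertices $w_1,\dots,w_t$, let $e^\dagger=(e\cup\{w_1,\dots,w_t\})\setminus\{v_1,\dots,v_t\}$, and let $H'$ have vertex set $V(H)\cup\{w_1,\dots,w_t\}$ and edge set $(E(H)\setminus\{e\})\cup\{e^\dagger\}$. *)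

(* Defs.v *)
From HB Require Import structures.
From mathcomp Require Import all_boot all_order all_algebra.
From mathcomp Require Import complex.
From mathcomp Require Import classical_sets reals.

Set Implicit Arguments.
Unset Strict Implicit.
Unset Printing Implicit Defensive.

Import Order.TTheory GRing.Theory Num.Theory.

Local Open Scope ring_scope.
Local Open Scope complex_scope.

(* A hypergraph on the finite vertex set V is its set of edges; it is simple
   because edges form a set of sets (no repeated edge, no repeated vertex). *)
Definition hypergraph (V : finType) := {set {set V}}.

Definition uniform (k : nat) (V : finType) (H : hypergraph V) : Prop :=
  forall e : {set V}, e \in H -> #|e| = k.

Definition degree (V : finType) (H : hypergraph V) (v : V) : nat :=
  #|[set e in H | v \in e]|.

Definition adjacent (V : finType) (H : hypergraph V) : rel V :=
  fun x y => [exists e in H, (x \in e) && (y \in e)].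

Definition connected (V : finType) (H : hypergraph V) : Prop :=
  forall x y : V, connect (adjacent H) x y.

(* Tensors of order k with every index ranging over V. *)
Definition tensor (C : Type) (k : nat) (V : finType) := k.-tuple V -> C.

(* (A x^(k-1))_v = \sum_(i_2, ..., i_k) A_(v, i_2, ..., i_k) x_(i_2)...x_(i_k) *)
Definition tensor_apply (C : comNzRingType) (k : nat) (V : finType)
    (A : tensor C k V) (x : {ffun V -> C}) (v : V) : C :=
  \sum_(i : k.-tuple V | ohead i == Some v) A i * \prod_(u <- behead i) x u.

Definition tensor_eigenvalue (C : comNzRingType) (k : nat) (V : finType)
    (A : tensor C k V) (l : C) : Prop :=
  exists2 x : {ffun V -> C}, x != 0 &
    forall v : V, tensor_apply A x v = l * x v ^+ k.-1.

(* [complex.Re `|l|] is the modulus of l seen as an element of R.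
   For k >= 2 a tensor has finitely many eigenvalues, and at least one if V is
   nonempty, so this supremum is the maximal modulus. *)
Definition spectral_radius (R : realType) (k : nat) (V : finType)
    (A : tensor R[i] k V) : R :=
  sup [set r : R | exists2 l : R[i], tensor_eigenvalue A l &
                                     r = complex.Re `|l|]%classic.

(* If H is k-uniform, a k-tuple whose entries form an edge has no repetition. *)
Definition adjacency_tensor (R : realType) (k : nat) (V : finType)
    (H : hypergraph V) : tensor R[i] k V :=
  fun i => if [set u in i] \in H then (k.-1)`!%:R^-1 else 0.

Definition rho (R : realType) (k : nat) (V : finType) (H : hypergraph V) : R :=
  spectral_radius (@adjacency_tensor R k V H).

Definition alpha (R : realType) (k : nat) (V : finType) (H : hypergraph V) : R :=
  rho R k H ^- k.

(* The vertex set V(H) + {w_1, ..., w_t} is the disjoint sum V + 'I_t. *)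
Definition released_edge (V : finType) (t : nat) (e : {set V})
    (v : 'I_t -> V) : {set V + 'I_t} :=
  ([set inl u | u in e] :|: [set inr i | i : 'I_t])
    :\: [set inl (v i) | i : 'I_t].

Definition release (V : finType) (t : nat) (H : hypergraph V) (e : {set V})
    (v : 'I_t -> V) : hypergraph (V + 'I_t)%type :=
  [set [set inl u | u in f] | f : {set V} in H :\ e] :|: [set released_edge e v].

(* Main.v *)
From HB Require Import structures.
From mathcomp Require Import all_boot all_order all_algebra.
From mathcomp Require Import complex.
From mathcomp Require Import ring.
From mathcomp Require Import boolp classical_sets reals.
From mathcomp Require Import topology normedtype derive realfun.
(* Restores the lemma names of finite sets shadowed by classical_sets. *)
From mathcomp Require Import fintype finset.
Require Import Defs.

(* Maximizing \sum_(f in H) \prod_(v in f) y v over \sum_v y v ^+ k on the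
   nonnegative orthant yields a nonnegative eigenvector whose eigenvalue
   dominates the modulus of every other one, hence equals rho(H); when H is
   connected this eigenvector x is positive.  Give each new vertex w_i of the
   released hypergraph H' the value x_(v_i).  The products of x over the edges
   do not change, so A(H') x <= rho(H) x^[k-1], with strict inequality at the
   v_i (which lost the edge e) and at the w_i (which lie in a single edge,
   whereas v_i has degree at least 2).  Every component of H' contains such a
   vertex, and comparing a Perron vector of H' with x at the vertices where
   their ratio is maximal gives rho(H') < rho(H). *)

Set Implicit Arguments.
Unset Strict Implicit.
Unset Printing Implicit Defensive.

Import Order.TTheory GRing.Theory Num.Theory.
Import numFieldNormedType.Exports.

Local Open Scope ring_scope.

(** * Edge sums and the adjacency tensor *)

Definition edge_apply (C : comNzRingType) (V : finType) (H : hypergraph V)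
    (x : V -> C) (v : V) : C :=
  \sum_(f in H | v \in f) \prod_(u in f :\ v) x u.

(** Multiplying the eigenvalue equation at [v] by [x v] turns its left side into this sum, in which
    only products over whole edges occur. *)
Definition edge_weight (C : comNzRingType) (V : finType) (H : hypergraph V)
    (x : V -> C) (v : V) : C :=
  \sum_(f in H | v \in f) \prod_(u in f) x u.

Definition edge_poly (C : comNzRingType) (V : finType) (H : hypergraph V)
    (x : V -> C) : C :=
  \sum_(f in H) \prod_(u in f) x u.

Definition pow_sum (C : comNzRingType) (k : nat) (V : finType)
    (x : V -> C) : C :=
  \sum_v x v ^+ k.
Arguments pow_sum {C} k {V} x.

Lemma edge_weightE (C : comNzRingType) (V : finType) (H : hypergraph V)
    (x : V -> C) v : edge_weight H x v = x v * edge_apply H x v.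
Proof.
rewrite /edge_apply mulr_sumr; apply: eq_bigr => f /andP[_ vf].
by rewrite (big_setD1 v).
Qed.

Lemma sum_edge_weight (C : comNzRingType) (k : nat) (V : finType)
    (H : hypergraph V) (x : V -> C) :
  uniform k H -> \sum_v edge_weight H x v = k%:R * edge_poly H x.
Proof.
move=> Hk; rewrite /edge_weight /edge_poly mulr_sumr.
rewrite (exchange_big_dep (mem H)) /=; last by move=> v f _ /andP[].
apply: eq_bigr => f fH; under eq_bigl do rewrite fH /=.
by rewrite sumr_const (Hk f fH) mulr_natl.
Qed.

(** A tuple of length [n.+1] spanning [f] has no repetition, so its tail is an arbitrary ordering of
    [f :\ v]. *)
Lemma card_tuples_spanning (n : nat) (V : finType) (f : {set V}) (v : V) :
  #|f| = n.+1 -> v \in f ->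
  #|[set i : n.+1.-tuple V | (ohead i == Some v) && ([set u in i] == f)]|
    = n`!.
Proof.
move=> cf vf; pose D := [set t : n.-tuple V | all (mem (f :\ v)) t & uniq t].
have cD : #|D| = n`!.
  rewrite card_uniq_tuples -ffactnn; congr (_ ^_ _).
  by apply/eqP; rewrite -eqSS -cf (cardsD1 v) vf.
pose cons_v (t : n.-tuple V) := [tuple of v :: t].
rewrite -cD -(card_imset (mem D) (f := cons_v)).
  apply: eq_card => i; rewrite inE; apply/idP/imsetP => [|[t]]; last first.
    rewrite inE => /andP[/allP tf ut] -> /=; rewrite eqxx /=.
    rewrite eqEcard; apply/andP; split.
      apply/subsetP => u; rewrite !inE => /orP[/eqP-> //|/tf].
      by rewrite !inE => /andP[].
    rewrite cf cardsE (card_uniqP _) /= ?size_tuple // ut andbT.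
    by apply/negP => /tf; rewrite !inE eqxx.
  case/tupleP: i => a t /= /andP[/eqP[->] /eqP ft].
  exists t; last exact/val_inj.
  have : uniq (v :: t).
    apply/card_uniqP; rewrite /= size_tuple -cf -ft cardsE.
    by apply: eq_card => u; rewrite inE.
  rewrite /= => /andP[vt ut]; rewrite inE ut andbT.
  apply/allP => u ut'; rewrite /= !inE -ft !inE ut' orbT andbT.
  by apply: contraNneq vt => <-.
by move=> t1 t2 /(congr1 val) /= [/val_inj].
Qed.

(** Grouping the tuples by the edge they span, the n! equal terms of each edge cancel the
    normalization of the tensor. *)
Lemma tensor_apply_adjacency (R : realType) (n : nat) (V : finType)
    (H : hypergraph V) (x : {ffun V -> R[i]}) v :
  uniform n.+1 H ->
  tensor_apply (adjacency_tensor R (k := n.+1) H) x v = edge_apply H x v.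
Proof.
move=> Hk; rewrite /tensor_apply /edge_apply /adjacency_tensor /=.
under eq_bigr do rewrite (fun_if (fun z => z * _)) mul0r.
rewrite -big_mkcondr /=.
rewrite (partition_big (fun i : n.+1.-tuple V => [set u in i])
  (fun f => (f \in H) && (v \in f))) /=; last first.
  move=> i /andP[/eqP iv ->]; rewrite inE /=.
  by case/tupleP: i iv => a t /= [->]; rewrite inE eqxx.
apply: eq_bigr => f /andP[fH vf].
have cf := Hk f fH.
under eq_bigl => i.
  rewrite -andbA (_ : (_ \in H) && _ = ([set u in i] == f)); last first.
    by case: eqP => [->|]; rewrite ?fH ?andbF.
  over.
rewrite (eq_bigr (fun=> n`!%:R^-1 * \prod_(u in f :\ v) x u)).
  rewrite -big_distrl /= sumr_const -cardsE card_tuples_spanning //.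
  rewrite -[_ *+ n`!]mulr_natl mulfV ?mul1r // pnatr_eq0 -lt0n.
  exact: fact_gt0.
move=> i /andP[/eqP + /eqP ft].
case/tupleP: i ft => a t /= ft [av]; subst a; congr (_ * _).
have : uniq (v :: t).
  apply/card_uniqP; rewrite /= size_tuple -cf -ft cardsE.
  by apply: eq_card => u; rewrite inE.
rewrite /= => /andP[vt ut]; rewrite big_uniq //.
apply: eq_bigl => u; rewrite -ft !inE.
by case: eqVneq vt => //= ->; move/negbTE.
Qed.

(** * Existence of a maximizer on the nonnegative orthant *)

Lemma pow_sum_gt0 (R : realDomainType) (k : nat) (V : finType) (y : V -> R) :
  (forall v, 0 <= y v) -> (exists v, y v != 0) -> 0 < pow_sum k y.
Proof.
move=> y0 [v yv]; rewrite /pow_sum (bigD1 v) //= ltr_pwDl //.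
  by rewrite exprn_gt0 // lt0r yv y0.
by apply: sumr_ge0 => u _; rewrite exprn_ge0.
Qed.

Lemma continuous_edge_poly (R : realType) (V : finType) (H : hypergraph V) :
  continuous (edge_poly H : {ptws V -> R} -> R).
Proof.
apply: continuous_big => [|f _]; first exact: add_continuous.
apply: continuous_big => [|v _]; first exact: mul_continuous.
exact: (@proj_continuous V (fun=> R) v).
Qed.

Lemma continuous_pow_sum (R : realType) (k : nat) (V : finType) :
  continuous (pow_sum k : {ptws V -> R} -> R).
Proof.
apply: continuous_big => [|v _]; first exact: add_continuous.
move=> y; apply: (@continuous_comp _ _ _ (fun y : {ptws V -> R} => y v)
  (fun r : R => r ^+ k)); last exact: exprn_continuous.
exact: (@proj_continuous V (fun=> R) v).
Qed.

(** The ratio to be maximized is homogeneous of degree 0, so a compact section of the orthant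
    suffices; normalizing the plain sum avoids roots. [{ptws V -> R}] carries the product topology,
    for which Tychonoff's theorem applies. *)
Definition simplex (R : realType) (V : finType) : set {ptws V -> R} :=
  [set y : {ptws V -> R} | (forall v, 0 <= y v) /\ \sum_v y v = 1]%classic.

Lemma compact_simplex (R : realType) (V : finType) : compact (@simplex R V).
Proof.
pose box := [set y : {ptws V -> R} | forall v, `[0, 1]%classic (y v)]%classic.
have cbox : compact box.
  apply: (@tychonoff V (fun=> R) (fun=> `[0, 1]%classic)) => v.
  exact: segment_compact.
pose S := ((fun y : {ptws V -> R} => \sum_v y v) @^-1` [set 1 : R])%classic.
have clS : closed S.
  apply: closed_comp => [y _|]; last exact: closed_eq.
  apply: continuous_big => [|v _]; first exact: add_continuous.
  exact: (@proj_continuous V (fun=> R) v).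
have -> : @simplex R V = (box `&` S)%classic.
  apply/seteqP; split => y /= [y0 y1]; split => // v.
    suff: y v \in `[0, 1]%R by [].
    rewrite in_itv /= y0 /=.
    rewrite -y1 (bigD1 v) //= lerDl.
    by apply: sumr_ge0 => u _; apply: y0.
  have : y v \in `[0, 1]%R by exact: y0.
  by rewrite in_itv /= => /andP[].
exact: compact_closedI.
Qed.

(** [M] is the maximum of the ratio of [edge_poly H] to [pow_sum k], attained at [y]. The form
    without division or normalization admits every nonnegative test vector, zero included. *)
Definition edge_maximizer (R : realType) (k : nat) (V : finType)
    (H : hypergraph V) (M : R) (y : V -> R) : Prop :=
  [/\ forall v, 0 <= y v, exists v, y v != 0,
      edge_poly H y = M * pow_sum k y &
      forall z : V -> R, (forall v, 0 <= z v) ->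
        edge_poly H z <= M * pow_sum k z].

Lemma ex_edge_maximizer (R : realType) (k : nat) (V : finType)
    (H : hypergraph V) (v0 : V) :
  (0 < k)%N -> uniform k H -> exists M (y : V -> R), edge_maximizer k H M y.
Proof.
move=> k0 Hk.
have simplex_neq0 (y : {ptws V -> R}) : simplex y -> exists v, y v != 0.
  move=> [y0 y1]; apply/existsP; rewrite -negb_forall.
  apply/negP => /forallP y00.
  move/eqP: y1; rewrite big1 1?eq_sym ?oner_eq0 // => v _; exact/eqP/y00.
pose ratio (y : {ptws V -> R}) : R := edge_poly H y / pow_sum k y.
have [||y] := @compact_EVT_max _ R ratio _ _ (@compact_simplex R V).
- exists (fun v => (v == v0)%:R); split => [v|]; first exact: ler0n.
  by rewrite (bigD1 v0) //= eqxx big1 ?addr0 // => v /negbTE ->.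
- apply: continuous_in_subspaceT => y; rewrite in_setE => ys.
  have Ny : pow_sum k y != 0.
    by rewrite gt_eqF // pow_sum_gt0 //; [case: ys|exact: simplex_neq0].
  have cP := @continuous_edge_poly R V H y.
  exact: (cvgM cP (cvgV Ny (@continuous_pow_sum R k V y))).
rewrite in_setE => ys ymax; have [y0 y1] := ys.
have yn := simplex_neq0 _ ys; have Ny := pow_sum_gt0 k y0 yn.
exists (ratio y), y; split => //; first by rewrite divfK ?gt_eqF.
(* The zero vector cannot be scaled into the simplex. Both sides vanish there because [k] is
   positive and every edge is nonempty. *)
move=> z z0; have [z00|zn] := pselect (forall v, z v = 0).
  rewrite /edge_poly /pow_sum !big1 ?mulr0 // => [v _|f fH].
    by rewrite z00 expr0n gtn_eqF.
  have /card_gt0P[v vf] : (0 < #|f|)%N by rewrite (Hk f fH).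
  by rewrite (bigD1 v) //= z00 mul0r.
have {}zn : exists v, z v != 0.
  by apply: contra_notP zn => zn v; apply: contra_notP zn => /eqP; exists v.
pose c := \sum_v z v.
have c0 : 0 < c.
  have [v zv] := zn; rewrite /c (bigD1 v) //= ltr_pwDl ?sumr_ge0 //.
  by rewrite lt0r zv z0.
have := ymax (fun v => z v / c); rewrite in_setE.
have zs : simplex (fun v => z v / c).
  split => [v|]; first by rewrite divr_ge0 ?z0 ?ltW.
  by rewrite -mulr_suml divff ?gt_eqF.
move=> /(_ zs); rewrite {1}/ratio ler_pdivrMr; last first.
  by apply: pow_sum_gt0; [case: zs|exact: simplex_neq0].
have -> : pow_sum k (fun v => z v / c) = pow_sum k z / c ^+ k.
  by rewrite /pow_sum mulr_suml; apply: eq_bigr => v _; rewrite expr_div_n.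
have -> : edge_poly H (fun v => z v / c) = edge_poly H z / c ^+ k.
  rewrite /edge_poly mulr_suml; apply: eq_bigr => f fH.
  by rewrite big_split /= prodr_const (Hk f fH) exprVn.
by rewrite mulrA ler_pM2r // invr_gt0 exprn_gt0.
Qed.

(** * Maximizers are eigenvectors *)

(* Raising every zero of y inside a non-vanishing edge f to r gains at least a
   multiple of r ^ |zeros|, with |zeros| < k, and costs only O(r ^ k). *)
Lemma maximizer_edge_zero (R : realType) (k : nat) (V : finType)
    (H : hypergraph V) (M : R) (y : V -> R) (f : {set V}) (u v : V) :
  uniform k H -> edge_maximizer k H M y ->
  f \in H -> u \in f -> v \in f -> y u = 0 -> y v = 0.
Proof.
move=> Hk [y0 _ yM zM] fH uf vf yu; apply/eqP/negP => /negP yv.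
pose T := [set w in f | y w == 0].
have Tf : T \subset f by apply/subsetP => w; rewrite inE => /andP[].
have T0 : (0 < #|T|)%N by apply/card_gt0P; exists u; rewrite inE uf yu eqxx.
have Tk : (#|T| < k)%N.
  rewrite -(Hk f fH); apply: proper_card; apply/properP; split => //.
  by exists v => //; rewrite inE vf.
have fin w : w \in f -> (w \in T) = (y w == 0) by rewrite inE => ->.
have k0 : (0 < k)%N by exact: leq_ltn_trans Tk.
pose c := \prod_(w in f :\: T) y w.
have c0 : 0 < c.
  apply: prodr_gt0 => w; rewrite inE => /andP[wT wf].
  by rewrite lt0r y0 andbT -fin.
have ineq (r : R) : 0 < r -> r ^+ #|T| * c <= M * (#|T|%:R * r ^+ k).
  move=> r0; pose z w := if w \in T then r else y w.
  have z0 w : 0 <= z w by rewrite /z; case: ifP => // _; exact: ltW.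
  have yz w : y w <= z w.
    by rewrite /z inE; case: ifP => // /andP[_ /eqP->]; exact: ltW.
  have Nz : pow_sum k z = pow_sum k y + #|T|%:R * r ^+ k.
    rewrite /pow_sum (bigID (mem T)) /= [in RHS](bigID (mem T)) /=.
    rewrite [X in X + _ + _]big1 ?add0r => [|w]; last first.
      by rewrite inE => /andP[_ /eqP->]; rewrite expr0n gtn_eqF.
    rewrite addrC; congr (_ + _).
      by apply: eq_bigr => w /negbTE wT; rewrite /z wT.
    rewrite (eq_bigr (fun=> r ^+ k)) => [|w wT]; last by rewrite /z wT.
    by rewrite sumr_const mulr_natl.
  have zf : \prod_(w in f) z w = r ^+ #|T| * c.
    rewrite (big_setID T) /=; congr (_ * _).
      rewrite (setIidPr Tf) -prodr_const.
      by apply: eq_bigr => w wT; rewrite /z wT.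
    by apply: eq_bigr => w; rewrite inE /z => /andP[/negbTE->].
  have yf : \prod_(w in f) y w = 0 by rewrite (bigD1 u) //= yu mul0r.
  have := zM z z0; rewrite Nz mulrDr -yM; apply: contraLR; rewrite -!ltNge.
  rewrite -(ltrD2l (edge_poly H y)) => lt; apply: lt_le_trans lt _.
  rewrite /edge_poly (bigD1 f) //= [leRHS](bigD1 f) //= yf zf add0r addrC.
  rewrite lerD2r; apply: ler_sum => g _; apply: ler_prod => w _.
  by rewrite y0 yz.
have M0 : 0 <= M.
  have := ineq 1 ltr01; rewrite !expr1n mul1r mulr1 => /(lt_le_trans c0).
  by rewrite pmulr_lgt0 ?ltr0n // => /ltW.
pose B := M * #|T|%:R.
have B0 : 0 <= B by rewrite mulr_ge0.
(* This [r] satisfies [r <= 1] and [B * r < c]. As [#|T| < k], the power [r ^+ (k - #|T|)] is at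
   most [r], which contradicts [ineq] once [r ^+ #|T|] is cancelled. *)
pose r := c / (c + B).
have cB : 0 < c + B by rewrite ltr_pwDl.
have r0 : 0 < r by rewrite divr_gt0.
have r1 : r <= 1 by rewrite ler_pdivrMr // mul1r lerDl.
have := ineq r r0; rewrite mulrA -/B -(subnKC (ltnW Tk)) exprD mulrCA.
rewrite ler_pM2l ?exprn_gt0 // leNgt => /negP; apply.
apply: (@le_lt_trans _ _ (B * r)).
  rewrite ler_wpM2l // -[leRHS]expr1; apply: ler_wiXn2l => //; first exact: ltW.
  by rewrite subn_gt0.
by rewrite /r mulrA ltr_pdivrMr // mulrC ltr_pM2l // ltrDr.
Qed.

(** An edge contains [v] at most once, so [edge_poly] is affine in the coordinate at [v], with slope
    [edge_apply H y v]. *)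
Lemma edge_poly_update (C : comNzRingType) (V : finType) (H : hypergraph V)
    (y z : V -> C) (v : V) :
  (forall u, u != v -> z u = y u) ->
  edge_poly H z = edge_poly H y + (z v - y v) * edge_apply H y v.
Proof.
move=> zy; rewrite /edge_poly /edge_apply.
rewrite (bigID (fun f : {set V} => v \in f)) /=.
rewrite [in RHS](bigID (fun f : {set V} => v \in f)) /=.
rewrite [RHS]addrAC; congr (_ + _); last first.
  apply: eq_bigr => f /andP[_ vf]; apply: eq_bigr => u uf; apply: zy.
  by apply: contraNneq vf => <-.
rewrite mulr_sumr -big_split /=; apply: eq_bigr => f /andP[_ vf].
rewrite !(big_setD1 v vf) /= mulrBl addrC subrK; congr (_ * _).
by apply: eq_bigr => u; rewrite !inE => /andP[/zy].
Qed.

(** If [y v] is positive, it is an interior minimum in the coordinate at [v] of the gap between the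
    two sides of the maximality inequality, so the derivative vanishes. If [y v] is zero, each edge
    through [v] has another vertex, where [y] is zero as well, and both sides vanish. *)
Lemma maximizer_eigen (R : realType) (k : nat) (V : finType)
    (H : hypergraph V) (M : R) (y : V -> R) (v : V) :
  (1 < k)%N -> uniform k H -> edge_maximizer k H M y ->
  edge_apply H y v = k%:R * M * y v ^+ k.-1.
Proof.
move=> k1 Hk ymax; have [y0 _ yM zM] := ymax.
have [yv|yv] := eqVneq (y v) 0.
  rewrite yv expr0n -subn1 subn_eq0 leqNgt k1 mulr0 /edge_apply big1 // => f.
  move=> /andP[fH vf].
  have /card_gt0P[u ufv] : (0 < #|f :\ v|)%N.
    by move: k1; rewrite -(Hk f fH) (cardsD1 v) vf.
  rewrite (bigD1 u) //= (maximizer_edge_zero Hk ymax fH vf _ yv) ?mul0r //.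
  by move: ufv; rewrite inE => /andP[].
set D := edge_apply H y v; set a := y v.
have a0 : 0 < a by rewrite lt0r yv y0.
(* [p.[r]] is the gap [M * pow_sum k z - edge_poly H z], where [z] is [y] with its value at [v]
   replaced by [r]. *)
pose p : {poly R} := M *: ('X^k - (a ^+ k)%:P) - D *: ('X - a%:P).
have pE r : p.[r] = M * (r ^+ k - a ^+ k) - D * (r - a).
  by rewrite !hornerE.
have pa : p.[a] = 0 by rewrite pE !subrr !mulr0 subrr.
have p0 r : 0 <= r -> 0 <= p.[r].
  move=> r0; pose z u := if u == v then r else y u.
  have := zM z; rewrite (@edge_poly_update _ _ _ y z v); last first.
    by move=> u /negbTE uv; rewrite /z uv.
  have -> : pow_sum k z = pow_sum k y + (r ^+ k - a ^+ k).
    rewrite /pow_sum (bigD1 v) //= [in RHS](bigD1 v) //= /z eqxx -/a.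
    rewrite (eq_bigr (fun u => y u ^+ k)) => [|u /negbTE-> //].
    by ring.
  rewrite yM mulrDr lerD2l pE subr_ge0 /z eqxx -/a -/D mulrC; apply.
  by move=> u; case: ifP.
(* The interval from 0 to [2 * a] is a neighbourhood of [a] inside the positive reals, where [p] is
   known to be nonnegative. *)
have := @derive1_at_min R (horner p) 0 (2 * a) a.
case=> [|r _||r|_ pmin].
- by rewrite mulr_ge0 // ltW.
- exact: derivable_horner.
- by rewrite in_itv /= a0 mulr_natl mulr2n ltrDl.
- by rewrite in_itv /= => /andP[/ltW r0 _]; rewrite pa p0.
have [_] := is_derive_poly p a; rewrite {}pmin /p.
rewrite !poly.derivE !hornerE hornerMn hornerXn subr0 => /esym/eqP.
by rewrite subr_eq0 => /eqP <-; rewrite mulrC -mulrA mulr_natl mulrC mulrnAr.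
Qed.

Lemma edge_apply_rmorph (C D : comNzRingType) (g : {rmorphism C -> D})
    (V : finType) (H : hypergraph V) (x : V -> C) (v : V) :
  edge_apply H (g \o x) v = g (edge_apply H x v).
Proof.
rewrite /edge_apply rmorph_sum; apply: eq_bigr => f _.
by rewrite rmorph_prod.
Qed.

Lemma edge_apply_norm (C : numDomainType) (V : finType) (H : hypergraph V)
    (x : V -> C) (v : V) :
  `|edge_apply H x v| <= edge_apply H (fun u => `|x u|) v.
Proof.
apply: le_trans (ler_norm_sum _ _ _) _; apply: ler_sum => f _.
by rewrite normr_prod.
Qed.

(** * The spectral radius as a maximum *)

(** By the triangle inequality the entrywise moduli of an eigenvector satisfy the eigenvalue
    equation as an inequality. Summed over the vertices, it counts every edge [n.+1] times, and the
    bound on [edge_poly] applies. *)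
Lemma tensor_eigenvalue_le (R : realType) (n : nat) (V : finType)
    (H : hypergraph V) (M : R) (l : R[i]) :
  uniform n.+1 H ->
  (forall z : V -> R, (forall v, 0 <= z v) ->
     edge_poly H z <= M * pow_sum n.+1 z) ->
  tensor_eigenvalue (adjacency_tensor R (k := n.+1) H) l ->
  complex.Re `|l| <= n.+1%:R * M.
Proof.
move=> Hk zM [x x0 xl].
have normE (z : R[i]) : `|z| = (complex.Re `|z|)%:C%C by rewrite normc_def.
pose y v := complex.Re `|x v|.
have y0 v : 0 <= y v by have := normr_ge0 (x v); rewrite normE lecR.
have yn : exists v, y v != 0.
  apply/existsP; rewrite -negb_forall; apply: contra x0 => /forallP yz.
  apply/eqP/ffunP => v; rewrite ffunE; apply/normr0_eq0.
  by rewrite normE; have /eqP := yz v; rewrite /y => ->.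
set L := complex.Re `|l|.
have le v : L * y v ^+ n.+1 <= edge_weight H y v.
  rewrite exprS mulrCA edge_weightE ler_wpM2l // -lecR.
  rewrite rmorphM rmorphXn /= -!normE -normrX -normrM.
  rewrite -[n]/(n.+1.-1) -xl tensor_apply_adjacency //.
  apply: le_trans (edge_apply_norm _ _ _) _.
  rewrite -(edge_apply_rmorph (real_complex R)) le_eqVlt; apply/orP; left.
  by apply/eqP; apply: eq_bigr => f _; apply: eq_bigr => u _; apply: normE.
have N0 := pow_sum_gt0 n.+1 y0 yn.
rewrite -(ler_pM2r N0) -mulrA.
apply: le_trans (_ : n.+1%:R * edge_poly H y <= _); last first.
  by rewrite ler_wpM2l // zM.
by rewrite -sum_edge_weight // mulr_sumr; apply: ler_sum.
Qed.

Lemma maximizer_tensor_eigenvalue (R : realType) (n : nat) (V : finType)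
    (H : hypergraph V) (M : R) (y : V -> R) :
  uniform n.+2 H -> edge_maximizer n.+2 H M y ->
  tensor_eigenvalue (adjacency_tensor R (k := n.+2) H) (n.+2%:R * M)%:C%C.
Proof.
move=> Hk ymax; have [_ [v yv] _ _] := ymax.
exists [ffun v => (y v)%:C%C].
  apply: contra yv => /eqP/ffunP/(_ v); rewrite !ffunE.
  by move=> /(congr1 (@complex.Re R)) /= ->.
move=> u; rewrite tensor_apply_adjacency // ffunE.
transitivity (edge_apply H (real_complex R \o y) u).
  by apply: eq_bigr => f _; apply: eq_bigr => w _; rewrite ffunE.
by rewrite edge_apply_rmorph (maximizer_eigen _ _ Hk ymax) // rmorphM rmorphXn.
Qed.

(** The upper bound on the moduli is itself the modulus of an eigenvalue, given by the maximizer, so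
    the supremum is attained. *)
Lemma rho_maximizer (R : realType) (n : nat) (V : finType)
    (H : hypergraph V) (M : R) (y : V -> R) :
  uniform n.+2 H -> edge_maximizer n.+2 H M y -> rho R n.+2 H = n.+2%:R * M.
Proof.
move=> Hk ymax; have [y0 yn yM zM] := ymax.
have M0 : 0 <= M.
  rewrite -(pmulr_lge0 _ (pow_sum_gt0 n.+2 y0 yn)) -yM.
  by apply: sumr_ge0 => f _; apply: prodr_ge0.
have ev := maximizer_tensor_eigenvalue Hk ymax.
rewrite /rho /spectral_radius; set S := (X in sup X).
have SkM : S (n.+2%:R * M).
  exists (n.+2%:R * M)%:C%C => //.
  by rewrite normc_def /= expr0n addr0 sqrtr_sqr ger0_norm // mulr_ge0.
have Sub : ubound S (n.+2%:R * M).
  by move=> r [l le ->]; exact: (tensor_eigenvalue_le Hk zM le).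
apply/eqP; rewrite eq_le; apply/andP; split.
  by apply: ge_sup => //; exists (n.+2%:R * M).
by apply: ub_le_sup => //; exists (n.+2%:R * M).
Qed.

(** Connectedness is not assumed, so [y] may have zeros. The last clause, that zeros spread along
    edges, yields positivity as soon as the hypergraph is connected. *)
Lemma perron (R : realType) (n : nat) (V : finType) (H : hypergraph V)
    (v0 : V) :
  uniform n.+2 H ->
  exists y : V -> R,
    [/\ forall v, 0 <= y v, exists v, y v != 0,
        forall v, edge_weight H y v = rho R n.+2 H * y v ^+ n.+2 &
        forall f u v, f \in H -> u \in f -> v \in f -> y u = 0 -> y v = 0].
Proof.
move=> Hk; have [M [y ymax]] := ex_edge_maximizer R v0 (isT : 0 < n.+2)%N Hk.
exists y; have [y0 yn yM zM] := ymax; split => // [v|f u v].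
  rewrite edge_weightE (maximizer_eigen _ _ Hk ymax) // (rho_maximizer Hk ymax).
  by rewrite mulrCA -exprS.
exact: maximizer_edge_zero Hk ymax.
Qed.

(** The constant vector 1 has positive [edge_poly] as soon as there is an edge, which forces [M] to
    be positive. *)
Lemma rho_gt0 (R : realType) (n : nat) (V : finType) (H : hypergraph V)
    (f : {set V}) :
  uniform n.+2 H -> f \in H -> 0 < rho R n.+2 H.
Proof.
move=> Hk fH; have /card_gt0P[v0 _] : (0 < #|f|)%N by rewrite (Hk f fH).
have [M [y ymax]] := ex_edge_maximizer R v0 (isT : 0 < n.+2)%N Hk.
rewrite (rho_maximizer Hk ymax) mulr_gt0 //; have [_ _ _ zM] := ymax.
have := zM (fun=> 1) (fun=> ler01); apply: contraLR; rewrite -leNgt -ltNge.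
move=> M0; apply: (@le_lt_trans _ _ 0).
  by rewrite mulr_le0_ge0 // sumr_ge0 // => v _; rewrite exprn_ge0.
rewrite /edge_poly (bigD1 f) //= ltr_pwDl ?prodr_gt0 //.
by apply: sumr_ge0 => g _; apply: prodr_ge0.
Qed.

(** * Comparison with a positive supersolution *)

(** Such sets are unions of connected components off the isolated vertices. They stand in for
    connectedness in the released hypergraph, which may be disconnected. *)
Definition edge_closed (V : finType) (H : hypergraph V) (Z : pred V) : Prop :=
  forall f u v, f \in H -> u \in f -> v \in f -> Z u -> Z v.

Lemma connected_edge_closed (V : finType) (H : hypergraph V) (Z : pred V) u v :
  connected H -> edge_closed H Z -> Z u -> Z v.
Proof.
move=> Hc HZ Zu; have /connectP[p] := Hc u v.
elim: p u Zu => [|w p IHp] u Zu /=; first by move=> _ ->.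
by move=> /andP[/existsP[f /and3P[fH uf wf]]]; apply: IHp; exact: HZ uf wf Zu.
Qed.

(* If lambda >= mu, then the set of vertices maximizing y / x is edge-closed and
   the supersolution x is an exact solution there. *)
Lemma collatz_wielandt_lt (R : realFieldType) (k : nat) (V : finType)
    (H : hypergraph V) (x y : V -> R) (lambda mu : R) :
  uniform k H ->
  (forall v, 0 < x v) -> (forall v, edge_weight H x v <= mu * x v ^+ k) ->
  (forall v, 0 <= y v) -> (exists v, y v != 0) ->
  (forall v, edge_weight H y v = lambda * y v ^+ k) ->
  (forall Z u, edge_closed H Z -> Z u ->
     exists2 v, Z v & edge_weight H x v < mu * x v ^+ k) ->
  lambda < mu.
Proof.
move=> Hk x0 xmu y0 [v1 yv1] ylambda Zstrict; rewrite ltNge; apply/negP => lemu.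
have [v0 _ v0max] := @arg_maxP _ R V v1 xpredT (fun v => y v / x v) isT.
pose c := y v0 / x v0.
have ycx v : y v <= c * x v by rewrite -ler_pdivrMr //; apply: v0max.
have c0 : 0 < c.
  rewrite -(pmulr_lgt0 c (x0 v1)); apply: lt_le_trans (ycx v1).
  by rewrite lt0r yv1 y0.
pose Z v := y v == c * x v.
have prod_le f : f \in H -> \prod_(u in f) y u <= c ^+ k * \prod_(u in f) x u.
  move=> fH; rewrite -(Hk f fH) -prodr_const -big_split /=.
  by apply: ler_prod => u _; rewrite y0 ycx.
have weight_le v : edge_weight H y v <= c ^+ k * edge_weight H x v.
  rewrite /edge_weight mulr_sumr; apply: ler_sum => f /andP[fH _].
  exact: prod_le.
(* On [Z] the value [y v] is exactly [c * x v], so [mu <= lambda] gives a lower bound that meets the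
   upper bound [weight_le]. *)
have Zle v : Z v -> c ^+ k * (mu * x v ^+ k) <= edge_weight H y v.
  move=> /eqP Zv; rewrite ylambda Zv mulrCA -exprMn ler_wpM2r // exprn_ge0 //.
  by rewrite mulr_ge0 // ltW.
have Zexact v : Z v -> edge_weight H x v = mu * x v ^+ k.
  move=> Zv; apply/eqP; rewrite eq_le xmu /= -(ler_pM2l (exprn_gt0 k c0)).
  exact: le_trans (Zle v Zv) (weight_le v).
have Zclosed : edge_closed H Z.
  move=> f u v fH uf vf Zu; apply/negPn/negP => Zv.
  have : edge_weight H y u < c ^+ k * edge_weight H x u.
    rewrite /edge_weight mulr_sumr (bigD1 f) ?fH //= [ltRHS](bigD1 f) ?fH //=.
    rewrite ltr_leD //; last first.
      by apply: ler_sum => g /andP[/andP[gH _] _]; exact: prod_le.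
    rewrite -(Hk f fH) -prodr_const -big_split /=.
    rewrite (bigD1 v) //= [ltRHS](bigD1 v) //=.
    (* The factors away from [v] are first replaced by the positive [c * x w], since [y w] may
       vanish; the strict inequality at [v] then survives the multiplication. *)
    apply: le_lt_trans (_ : y v * \prod_(w in f | w != v) (c * x w) < _).
      by rewrite ler_wpM2l //; apply: ler_prod => w _; rewrite y0 ycx.
    rewrite ltr_pM2r; first by rewrite lt_neqAle ycx andbT.
    by apply: prodr_gt0 => w _; rewrite mulr_gt0.
  by rewrite ltNge Zexact // Zle.
have Zv0 : Z v0 by rewrite /Z /c divfK // gt_eqF.
have [v Zv] := Zstrict Z v0 Zclosed Zv0.
by rewrite Zexact // ltxx.
Qed.

(** The zeros of the Perron vector form an edge-closed set, so in a connected hypergraph a single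
    zero would make the vector vanish everywhere. *)
Lemma perron_positive (R : realType) (n : nat) (V : finType)
    (H : hypergraph V) (v0 : V) :
  uniform n.+2 H -> connected H ->
  exists2 x : V -> R, forall v, 0 < x v &
    forall v, edge_weight H x v = rho R n.+2 H * x v ^+ n.+2.
Proof.
move=> Hk Hc; have [x [x0 [v xv] eig zero]] := perron R v0 Hk.
exists x => // u; rewrite lt0r x0 andbT; apply: contra xv.
apply: (connected_edge_closed (Z := fun v => x v == 0)) => // f w w'.
by move=> fH wf wf' /eqP xw; apply/eqP; exact: zero fH wf wf' xw.
Qed.

(** * The released hypergraph *)

(* Merging each new vertex with the one it replaces is injective on every edge
   of the released hypergraph and maps the released edge back onto e; hence
   the lift x \o merge has the same edge products as x. *)
Definition merge (V : finType) (t : nat) (w : 'I_t -> V) (z : V + 'I_t) : V :=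
  match z with inl u => u | inr i => w i end.

Lemma mem_inl_imset (V W : finType) (A : {set V}) u :
  (inl u \in [set (inl a : V + W) | a in A]) = (u \in A).
Proof. by rewrite mem_imset // => a b []. Qed.

Lemma mem_inr_imset (V W : finType) (A : {set V}) (i : W) :
  inr i \in [set (inl a : V + W) | a in A] = false.
Proof. by apply/negbTE/negP => /imsetP[]. Qed.

Lemma mem_released_edge_inl (V : finType) (t : nat) (e : {set V})
    (w : 'I_t -> V) u :
  (inl u \in released_edge e w) = (u \in e) && (u \notin codom w).
Proof.
rewrite in_setD in_setU mem_inl_imset andbC; congr (_ && ~~ _).
  by case: imsetP => [[]|]; rewrite ?orbF.
by apply/imsetP/codomP => [[i _ [->]]|[i ->]]; exists i.
Qed.

Lemma mem_released_edge_inr (V : finType) (t : nat) (e : {set V})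
    (w : 'I_t -> V) i :
  inr i \in released_edge e w.
Proof.
rewrite in_setD in_setU (imset_f (fun i : 'I_t => inr i)) // orbT andbT.
by apply/negP => /imsetP[].
Qed.

Lemma merge_released_edge (V : finType) (t : nat) (e : {set V})
    (w : 'I_t -> V) :
  (forall i, w i \in e) -> merge w @: released_edge e w = e.
Proof.
move=> we; apply/setP => u; apply/imsetP/idP => [[[a|i]] /=|ue].
- by rewrite mem_released_edge_inl => /andP[ae _] ->.
- by move=> _ ->.
- have [/codomP[i ->]|uw] := boolP (u \in codom w).
    by exists (inr i) => //; exact: mem_released_edge_inr.
  by exists (inl u) => //; rewrite mem_released_edge_inl ue.
Qed.

Lemma merge_released_edge_inj (V : finType) (t : nat) (e : {set V})
    (w : 'I_t -> V) :
  injective w -> {in released_edge e w &, injective (merge w)}.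
Proof.
move=> w_inj [a|i] [b|j] /=.
- by move=> _ _ ->.
- rewrite mem_released_edge_inl => /andP[_ /negP aw] _ aE.
  by case: aw; rewrite aE codom_f.
- rewrite mem_released_edge_inl => _ /andP[_ /negP aw] aE.
  by case: aw; rewrite -aE codom_f.
- by move=> _ _ /w_inj ->.
Qed.

Lemma uniform_release (k : nat) (V : finType) (t : nat) (H : hypergraph V)
    (e : {set V}) (w : 'I_t -> V) :
  uniform k H -> e \in H -> injective w -> (forall i, w i \in e) ->
  uniform k (release H e w).
Proof.
move=> Hk eH w_inj we g; rewrite in_setU => /orP[/imsetP[f fH ->]|].
  rewrite card_imset; last by move=> a b [].
  by apply: Hk; move: fH; rewrite inE => /andP[].
rewrite inE => /eqP->.
rewrite -(card_in_imset (@merge_released_edge_inj _ _ e w w_inj)).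
by rewrite merge_released_edge // Hk.
Qed.

(** As [t] is positive, the released edge contains some [inr i], hence differs from every embedded
    old edge, and the union is disjoint. *)
Lemma sum_release (C : nmodType) (V : finType) (t : nat) (H : hypergraph V)
    (e : {set V}) (w : 'I_t -> V) (F : {set V + 'I_t} -> C) :
  (0 < t)%N ->
  \sum_(g in release H e w) F g =
    \sum_(f in H :\ e) F [set inl u | u in f] + F (released_edge e w).
Proof.
move=> t0; rewrite /release setUC big_setU1 /=; last first.
  apply/negP => /imsetP[f _ ef].
  have := mem_released_edge_inr e w (Ordinal t0).
  by rewrite ef mem_inr_imset.
by rewrite addrC big_imset //= => f g _ _; apply: imset_inj => a b [].
Qed.

(** Only the vertices [w i] lose a term: at every other vertex of [e] the released edge replaces [e]
    with the same product. *)
Lemma edge_weight_release_inl (C : comNzRingType) (V : finType) (t : nat)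
    (H : hypergraph V) (e : {set V}) (w : 'I_t -> V) (x : V -> C) u :
  (0 < t)%N -> e \in H -> injective w -> (forall i, w i \in e) ->
  edge_weight (release H e w) (x \o merge w) (inl u) =
    edge_weight H x u - (if u \in codom w then \prod_(a in e) x a else 0).
Proof.
move=> t0 eH w_inj we; rewrite /edge_weight big_mkcondr sum_release //.
rewrite -(big_imset x (@merge_released_edge_inj _ _ e w w_inj)).
rewrite merge_released_edge // mem_released_edge_inl.
rewrite [in RHS]big_mkcondr [in RHS](big_setD1 e) //=.
rewrite addrAC [RHS]addrC; congr (_ + _); last first.
  case: (boolP (u \in codom w)) => uw; last by rewrite andbT subr0.
  by rewrite andbF; case/codomP: uw => i ->; rewrite we subrr.
apply: eq_bigr => f _; rewrite mem_inl_imset.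
by rewrite big_imset //= => a b _ _ [].
Qed.

Lemma edge_weight_release_inr (C : comNzRingType) (V : finType) (t : nat)
    (H : hypergraph V) (e : {set V}) (w : 'I_t -> V) (x : V -> C) i :
  (0 < t)%N -> injective w -> (forall i, w i \in e) ->
  edge_weight (release H e w) (x \o merge w) (inr i) = \prod_(a in e) x a.
Proof.
move=> t0 w_inj we; rewrite /edge_weight big_mkcondr sum_release //.
rewrite -(big_imset x (@merge_released_edge_inj _ _ e w w_inj)).
rewrite merge_released_edge // mem_released_edge_inr big1 ?add0r // => f _.
by rewrite mem_inr_imset.
Qed.

(** If [Z] avoided all [w i] and all new vertices, its trace on [V] would be edge-closed in [H]: a
    vertex of [e] in the trace would lie in the released edge and carry [Z] to a new vertex.
    Connectedness of [H] would then bring the trace to some [w i]. *)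
Lemma release_edge_closed (V : finType) (t : nat) (H : hypergraph V)
    (e : {set V}) (w : 'I_t -> V) (Z : pred (V + 'I_t)) z :
  (0 < t)%N -> connected H -> edge_closed (release H e w) Z -> Z z ->
  exists i, Z (inl (w i)) || Z (inr i).
Proof.
move=> t0 Hc HZ Zz; apply/existsP; apply: contraT.
rewrite negb_exists => /forallP noZ.
have noZl i : Z (inl (w i)) = false by have /norP[/negbTE] := noZ i.
have noZr i : Z (inr i) = false by have /norP[_ /negbTE] := noZ i.
case: z Zz => [u|i] Zz; last by rewrite noZr in Zz.
have := @connected_edge_closed _ H (fun a => Z (inl a)) u (w (Ordinal t0)) Hc.
rewrite noZl; apply => // f a b fH af bf Za.
have [fe|fe] := eqVneq f e.
  have a_edge : inl a \in released_edge e w.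
    rewrite mem_released_edge_inl -fe af /=; apply/negP => /codomP[i ai].
    by move: Za; rewrite ai noZl.
  have eH' : released_edge e w \in release H e w by rewrite !inE eqxx orbT.
  have := HZ _ _ _ eH' a_edge (mem_released_edge_inr e w (Ordinal t0)) Za.
  by rewrite noZr.
apply: (HZ [set inl c | c in f] (inl a)); rewrite ?mem_inl_imset //.
by rewrite in_setU imset_f // !inE fe.
Qed.

(** * Strict decrease of the spectral radius *)

Lemma rho_release_lt (R : realType) (n : nat) (V : finType) (t : nat)
    (H : hypergraph V) (e : {set V}) (w : 'I_t -> V) :
  (0 < t)%N -> uniform n.+2 H -> connected H -> e \in H -> injective w ->
  (forall i, w i \in e) -> (forall i, (1 < degree H (w i))%N) ->
  rho R n.+2 (release H e w) < rho R n.+2 H.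
Proof.
move=> t0 Hk Hc eH w_inj we w_deg.
have H'k := uniform_release Hk eH w_inj we.
have [x x0 xeig] := perron_positive R (w (Ordinal t0)) Hk Hc.
have [y [y0 yn yeig _]] := perron R (inr (Ordinal t0)) H'k.
have e0 : 0 < \prod_(a in e) x a by apply: prodr_gt0.
(* Degree at least 2 provides a second edge through [w i], whose product is positive. This makes the
   inequality strict at the new vertices. *)
have w_lt i : \prod_(a in e) x a < edge_weight H x (w i).
  rewrite /edge_weight (bigD1 e) ?eH ?we //= ltrDl.
  have : (0 < #|[set f in H | w i \in f] :\ e|)%N.
    by have := w_deg i; rewrite /degree (cardsD1 e) inE eH we.
  case/card_gt0P => f; rewrite !inE => /and3P[fe fH wf].
  rewrite (bigD1 f) ?fH ?wf //= ltr_pwDl ?prodr_gt0 //.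
  by apply: sumr_ge0 => g _; apply: prodr_ge0 => a _; apply: ltW.
have strict i :
    edge_weight (release H e w) (x \o merge w) (inl (w i)) <
      rho R n.+2 H * x (w i) ^+ n.+2 /\
    edge_weight (release H e w) (x \o merge w) (inr i) <
      rho R n.+2 H * x (w i) ^+ n.+2.
  rewrite edge_weight_release_inl // edge_weight_release_inr // codom_f.
  by rewrite ltrBlDr -xeig ltrDl.
apply: (collatz_wielandt_lt (x := x \o merge w) (y := y) H'k) => //=.
- move=> [u|i] /=; last by have [_ /ltW] := strict i.
  rewrite edge_weight_release_inl // xeig gerBl.
  by case: ifP => // _; apply: ltW.
- move=> Z z HZ Zz; have [i /orP[Zi|Zi]] := release_edge_closed t0 Hc HZ Zz.
    by exists (inl (w i)) => //; case: (strict i).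
  by exists (inr i) => //; case: (strict i).
Qed.

Theorem theorem4p2 (R : realType) (k : nat) (V : finType) (H : hypergraph V)
    (e : {set V}) (s t : nat) (v : 'I_s -> V)
    (hk : (3 <= k)%N) (Hunif : uniform k H) (Hconn : connected H)
    (He : e \in H) (hs : (2 <= s)%N) (v_inj : injective v)
    (v_all : forall x : V,
       (x \in e /\ (2 <= degree H x)%N) <-> (exists i : 'I_s, v i = x))
    (ht1 : (1 <= t)%N) (hts : (t < s)%N) :
  let H' := release H e (fun i : 'I_t => v (widen_ord (ltnW hts) i)) in
  alpha R k H' > alpha R k H /\ rho R k H' < rho R k H.
Proof.
case: k hk Hunif => [//|[//|n]] _ Hk.
set w := fun i : 'I_t => _; move=> H'.
have v_e i : v i \in e /\ (1 < degree H (v i))%N by apply/v_all; exists i.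
have w_inj : injective w by move=> i j /v_inj /(congr1 val) /= /val_inj.
have we i : w i \in e by have [] := v_e (widen_ord (ltnW hts) i).
have lt_rho : rho R n.+2 H' < rho R n.+2 H.
  by apply: rho_release_lt => // i; have [] := v_e (widen_ord (ltnW hts) i).
split => //; rewrite /alpha.
have H'k := uniform_release Hk He w_inj we.
(* An edge of [H'] makes its spectral radius positive. This matters for [alpha], since the inverse
   of 0 is 0 and inversion reverses the order only among positive numbers. *)
have eH' : released_edge e w \in H' by rewrite !inE eqxx orbT.
have rho'0 := rho_gt0 R H'k eH'.
have rho0 := lt_trans rho'0 lt_rho.
by rewrite ltf_pV2 ?posrE ?exprn_gt0 // ltrXn2r // ?nnegrE ltW.
Qed.
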